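(* Let $\alpha,\beta,\gamma\in\mathbb C$ and $t^*\in\mathbb C\setminus\{0\}$, and let $f_1,f_2$ be linearly independent local solutions of $\mathcal L_{\alpha,\beta,\gamma}f=0$ on $\mathbb P^1(\mathbb C)_t$, where $$\mathcal L_{\alpha,\beta,\gamma}=D_t^2+\Bigl[\frac{\alpha+\beta}{t}+\frac{1-\alpha}{t-t^*}\Bigr]D_t+\frac{[\gamma^2-(1-\alpha-\beta)^2]\,t^*}{4t^2(t-t^* )}.$$ Let $\tau=f_1/f_2$, regard $t$ (locally) as a function of $\tau$ and $f_2$ as a function of $\tau$ via $t$, and let $u=\dot f_2/f_2$, with $u_4=\dot u-u^2$, $u_{k+2}=\dot u_k-k\,u\,u_k$ ($k=4,6,\dots$). Then $u$ satisfies $$C_{88}u_4^2u_8^2+C_{86}u_4u_6^2u_8+C_{84}u_4^4u_8+C_{66}u_6^4+C_{64}u_4^3u_6^2+C_{44}u_4^6=0,$$ where $C_{88}=(2\alpha-1)(2\beta-1)(\alpha+\beta-\gamma-1)^2(\alpha+\beta+\gamma-1)^2$, $C_{86}=-\bigl[(2\alpha-1)(3\beta-1)+(3\alpha-1)(2\beta-1)\bigr](\alpha+\beta-\gamma-1)^2(\alpha+\beta+\gamma-1)^2$, $C_{84}=-16(2\alpha-1)(2\beta-1)(\alpha+\beta-1)(\alpha+\beta-\gamma-1)(\alpha+\beta+\gamma-1)$, $C_{66}=(3\alpha-1)(3\beta-1)(\alpha+\beta-\gamma-1)^2(\alpha+\beta+\gamma-1)^2$, $C_{64}=4\bigl[2(2\alpha-1)^2(3\beta-1)+2(3\alpha-1)(2\beta-1)^2-3(\alpha-\beta)^2\bigr](\alpha+\beta-\gamma-1)(\alpha+\beta+\gamma-1)$,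 $C_{44}=64(2\alpha-1)(2\beta-1)(\alpha+\beta-1)^2$.
   Context: $D_t=d/dt$; a dot denotes $d/d\tau$. *)

(* Defs.v *)
From Stdlib Require Import Reals.
From Coquelicot Require Import Coquelicot.
Open Scope R_scope.
Open Scope C_scope.

(* The structures are fixed so that this is the differentiability for which
   [C_derive_correct] makes [C_derive] the complex derivative. *)
Definition complex_derivable (f : C -> C) (z : C) : Prop :=
  @ex_derive C_AbsRing C_NormedModule f z.

Definition coefL1 (alpha beta tstar t : C) : C :=
  (alpha + beta) / t + (1 - alpha) / (t - tstar).

Definition coefL0 (alpha beta gamma tstar t : C) : C :=
  ((gamma ^ 2 - (1 - alpha - beta) ^ 2) * tstar) / (4 * t ^ 2 * (t - tstar)).

Definition Lop (alpha beta gamma tstar : C) (f : C -> C) (t : C) : C :=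
  C_derive (C_derive f) t
  + coefL1 alpha beta tstar t * C_derive f t
  + coefL0 alpha beta gamma tstar t * f t.

(* [U] avoids the poles 0 and [tstar] of the coefficients, where division by
   zero would give [Lop] a meaningless value. *)
Definition solution_on (alpha beta gamma tstar : C) (U : C -> Prop)
    (f : C -> C) : Prop :=
  forall t, U t ->
    t <> 0 /\ t <> tstar /\
    complex_derivable f t /\ complex_derivable (C_derive f) t /\
    Lop alpha beta gamma tstar f t = 0.

Definition lin_indep_on (U : C -> Prop) (f1 f2 : C -> C) : Prop :=
  forall c1 c2 : C,
    (forall t, U t -> c1 * f1 t + c2 * f2 t = 0) -> c1 = 0 /\ c2 = 0.

(* [T], holomorphic on [V], is a branch of the inverse of tau = f1/f2, i.e. t
   as a function of tau; [f2 (T s) <> 0] keeps tau finite and u defined. *)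
Definition local_inverse_of_ratio (U V : C -> Prop) (f1 f2 T : C -> C)
    : Prop :=
  forall s, V s ->
    U (T s) /\ f2 (T s) <> 0 /\ complex_derivable T s /\
    f1 (T s) / f2 (T s) = s.

Definition log_derivative (F : C -> C) (s : C) : C := C_derive F s / F s.

(* [useq u j] is u_{2j+4}: index 0, 1, 2 gives u_4, u_6, u_8. *)
Fixpoint useq (u : C -> C) (j : nat) : C -> C :=
  match j with
  | O => fun s => C_derive u s - u s ^ 2
  | S i => fun s =>
      C_derive (useq u i) s - INR (2 * i + 4) * u s * useq u i s
  end.

Definition C88 (alpha beta gamma : C) : C :=
  (2 * alpha - 1) * (2 * beta - 1)
  * (alpha + beta - gamma - 1) ^ 2 * (alpha + beta + gamma - 1) ^ 2.

Definition C86 (alpha beta gamma : C) : C :=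
  - ((2 * alpha - 1) * (3 * beta - 1) + (3 * alpha - 1) * (2 * beta - 1))
  * (alpha + beta - gamma - 1) ^ 2 * (alpha + beta + gamma - 1) ^ 2.

Definition C84 (alpha beta gamma : C) : C :=
  - (16) * (2 * alpha - 1) * (2 * beta - 1) * (alpha + beta - 1)
  * (alpha + beta - gamma - 1) * (alpha + beta + gamma - 1).

Definition C66 (alpha beta gamma : C) : C :=
  (3 * alpha - 1) * (3 * beta - 1)
  * (alpha + beta - gamma - 1) ^ 2 * (alpha + beta + gamma - 1) ^ 2.

Definition C64 (alpha beta gamma : C) : C :=
  4 * (2 * (2 * alpha - 1) ^ 2 * (3 * beta - 1)
       + 2 * (3 * alpha - 1) * (2 * beta - 1) ^ 2
       - 3 * (alpha - beta) ^ 2)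
  * (alpha + beta - gamma - 1) * (alpha + beta + gamma - 1).

Definition C44 (alpha beta : C) : C :=
  64 * (2 * alpha - 1) * (2 * beta - 1) * (alpha + beta - 1) ^ 2.

(* Main.v *)
(** On a branch of the inverse of [tau = f1 / f2], the derivative of [t] with
    respect to [tau] is [x = f2 ^ 2 / w], where [w] is the Wronskian of [f1]
    and [f2].  Since [w' = - p w], one finds [x' = x (2 u + p x)], and the
    equation for [f2] gives [u_4 = - q x ^ 2].  Hence the operator
    [g' - 2 m u g] maps [h (t) x ^ m] to [(h' + m p h) (t) x ^ (m + 1)]: it
    preserves functions of [t] times powers of [x].  Thus [u_4], [u_6], [u_8]
    are explicit rational functions of [t] times [x ^ 2], [x ^ 3], [x ^ 4], the
    relation is homogeneous of degree 12 in [x], and it reduces to an identity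
    between rational functions of [t]. *)

Require Import Defs.
From Stdlib Require Import Reals Lra.
From Coquelicot Require Import Coquelicot.
Open Scope R_scope.
Open Scope C_scope.

(** * Complex differentiation *)

Definition is_Cderive (f : C -> C) (z l : C) : Prop :=
  @is_derive C_AbsRing C_NormedModule f z l.

(* The two normed-module structures on [C] have the same norm but different
   uniform structures; differentiability only sees the norm of the codomain. *)
Lemma is_Cderive_AbsRing (f : C -> C) (z l : C) :
  is_Cderive f z l <->
  @is_derive C_AbsRing (AbsRing_NormedModule C_AbsRing) f z l.
Proof.
  split; intros [[Hp Hs Hn] Hd]; split; try exact Hd; constructor; assumption.
Qed.

Lemma is_Cderive_eq (f : C -> C) (z l l' : C) :
  is_Cderive f z l -> l = l' -> is_Cderive f z l'.
Proof. intros H <-; exact H. Qed.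

Lemma is_Cderive_const (a z : C) : is_Cderive (fun _ => a) z 0.
Proof. exact (@is_derive_const C_AbsRing C_NormedModule a z). Qed.

Lemma is_Cderive_id (z : C) : is_Cderive (fun x => x) z 1.
Proof. apply is_Cderive_AbsRing, (@is_derive_id C_AbsRing). Qed.

Lemma is_Cderive_plus (f g : C -> C) (z l m : C) :
  is_Cderive f z l -> is_Cderive g z m ->
  is_Cderive (fun x => f x + g x) z (l + m).
Proof. exact (@is_derive_plus C_AbsRing C_NormedModule f g z l m). Qed.

Lemma is_Cderive_minus (f g : C -> C) (z l m : C) :
  is_Cderive f z l -> is_Cderive g z m ->
  is_Cderive (fun x => f x - g x) z (l - m).
Proof. exact (@is_derive_minus C_AbsRing C_NormedModule f g z l m). Qed.

Lemma is_Cderive_mult (f g : C -> C) (z l m : C) :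
  is_Cderive f z l -> is_Cderive g z m ->
  is_Cderive (fun x => f x * g x) z (l * g z + f z * m).
Proof.
  rewrite !is_Cderive_AbsRing; intros Hf Hg.
  exact (@is_derive_mult C_AbsRing f g z l m Hf Hg Cmult_comm).
Qed.

Lemma is_Cderive_comp (f g : C -> C) (z l m : C) :
  is_Cderive f (g z) l -> is_Cderive g z m ->
  is_Cderive (fun x => f (g x)) z (m * l).
Proof.
  rewrite (is_Cderive_AbsRing g); intros Hf Hg.
  exact (@is_derive_comp C_AbsRing C_NormedModule f g z l m Hf Hg).
Qed.

Lemma is_Cderive_pow (f : C -> C) (z l : C) (n : nat) :
  is_Cderive f z l ->
  is_Cderive (fun x => f x ^ S n) z (INR (S n) * f z ^ n * l).
Proof.
  intros Hf; induction n as [|n IH].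
  - eapply is_Cderive_eq.
    + exact (is_Cderive_mult f (fun _ => 1) z _ _ Hf (is_Cderive_const 1 z)).
    + simpl; ring.
  - eapply is_Cderive_eq.
    + apply (is_Cderive_mult f (fun x => f x ^ S n) z _ _ Hf IH).
    + rewrite (S_INR (S n)), RtoC_plus; simpl Cpow; ring.
Qed.

(** The remainder [/ y - / z + (y - z) / z ^ 2] equals [(y - z) ^ 2 / (y * z ^ 2)], hence is
    quadratic in [y - z]. *)
Lemma is_Cderive_inv_id (z : C) :
  z <> 0 -> is_Cderive (fun x => / x) z (- / z ^ 2).
Proof.
  intros Hz; split.
  - apply (@is_linear_scal_l C_AbsRing C_NormedModule).
  - intros x Hx eps.
    apply (@is_filter_lim_locally_unique C_AbsRing
             (AbsRing_NormedModule C_AbsRing)) in Hx.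
    subst x.
    pose proof (proj1 (Cmod_gt_0 z) Hz) as Hm.
    (* In the radius chosen below, [Cmod z / 2] keeps [Cmod y] above [Cmod z / 2]; then
       [eps * Cmod z ^ 3 / 2] puts the remainder under [eps * Cmod (y - z)]. *)
    assert (Hm3 : (0 < eps * Cmod z ^ 3 / 2)%R).
    { apply Rdiv_lt_0_compat; [|lra].
      apply Rmult_lt_0_compat; [apply cond_pos | apply pow_lt, Hm]. }
    assert (Hd : (0 < Rmin (Cmod z / 2) (eps * Cmod z ^ 3 / 2))%R)
      by (apply Rmin_pos; lra).
    exists (mkposreal _ Hd); intros y Hy; change C in y.
    change (Cmod (y - z) < Rmin (Cmod z / 2) (eps * Cmod z ^ 3 / 2))%R in Hy.
    change (Cmod ((/ y - / z) - (y - z) * - / z ^ 2)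
            <= eps * Cmod (y - z))%R.
    pose proof (Rlt_le_trans _ _ _ Hy (Rmin_l _ _)) as Hy1.
    pose proof (Rlt_le_trans _ _ _ Hy (Rmin_r _ _)) as Hy2.
    assert (Hym : (Cmod z / 2 < Cmod y)%R).
    { pose proof (Cmod_triangle y (- (y - z))) as Ht.
      rewrite Cmod_opp in Ht.
      replace (y + - (y - z)) with z in Ht by ring; lra. }
    assert (Hy0 : y <> 0) by (apply Cmod_gt_0; lra).
    replace ((/ y - / z) - (y - z) * - / z ^ 2)
      with ((y - z) * ((y - z) / (y * z ^ 2))) by (field; auto).
    rewrite Cmod_mult, (Rmult_comm eps).
    apply Rmult_le_compat_l; [apply Cmod_ge_0|].
    rewrite Cmod_div by (apply Cmult_neq_0; [exact Hy0 | apply Cpow_nz, Hz]).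
    rewrite Cmod_mult, Cmod_pow.
    assert (Hz2 : (0 < Cmod z ^ 2)%R) by apply pow_lt, Hm.
    apply Rle_div_l; [apply Rmult_lt_0_compat; lra|].
    apply Rle_trans with (eps * (Cmod z / 2 * Cmod z ^ 2))%R; [simpl in *; lra|].
    apply Rmult_le_compat_l; [apply Rlt_le, cond_pos|].
    apply Rmult_le_compat_r; lra.
Qed.

Lemma is_Cderive_div (f g : C -> C) (z l m : C) :
  is_Cderive f z l -> is_Cderive g z m -> g z <> 0 ->
  is_Cderive (fun x => f x / g x) z ((l * g z - f z * m) / g z ^ 2).
Proof.
  intros Hf Hg Hz; eapply is_Cderive_eq.
  - exact (is_Cderive_mult f (fun x => / g x) z _ _ Hf
             (is_Cderive_comp Cinv g z _ _ (is_Cderive_inv_id _ Hz) Hg)).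
  - cbv beta; field; exact Hz.
Qed.

Lemma is_Cderive_ext_open (V : C -> Prop) (f g : C -> C) (z l : C) :
  open V -> V z -> (forall x, V x -> f x = g x) ->
  is_Cderive f z l -> is_Cderive g z l.
Proof.
  intros HV Hz Heq; apply is_derive_ext_loc.
  (* [locally_C] passes from the product uniform structure on [C] to the one given by the
     modulus. *)
  apply (locally_C z (fun x => f x = g x)).
  exact (filter_imp _ _ Heq (HV z Hz)).
Qed.

Lemma complex_derivable_is_Cderive (f : C -> C) (z : C) :
  complex_derivable f z -> is_Cderive f z (C_derive f z).
Proof. exact (C_derive_correct f z 0). Qed.

(** Serves to climb the recursion: a formula valid on all of [V] for one term gives its
    differentiability and its derivative. *)
Lemma C_derive_ext_open (V : C -> Prop) (f g : C -> C) (z l : C) :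
  open V -> V z -> (forall x, V x -> g x = f x) ->
  is_Cderive f z l -> complex_derivable g z /\ C_derive g z = l.
Proof.
  intros HV Hz Heq Hf.
  assert (Hg : is_Cderive g z l).
  { apply (is_Cderive_ext_open V f); auto; intros x Hx; symmetry; auto. }
  split; [exists l; exact Hg | exact (is_C_derive_unique _ _ _ Hg)].
Qed.

(** * The inverse of the ratio of two solutions *)

Definition wronskian (f1 f2 : C -> C) (t : C) : C :=
  C_derive f1 t * f2 t - f1 t * C_derive f2 t.

(** Abel's identity: the products of first derivatives cancel, and the two equations eliminate the
    second derivatives. *)
Lemma wronskian_derive (alpha beta gamma tstar : C) (U : C -> Prop)
    (f1 f2 : C -> C) (t : C) :
  solution_on alpha beta gamma tstar U f1 ->
  solution_on alpha beta gamma tstar U f2 -> U t ->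
  is_Cderive (wronskian f1 f2) t
    (- coefL1 alpha beta tstar t * wronskian f1 f2 t).
Proof.
  intros H1 H2 Ht.
  destruct (H1 t Ht) as (_ & _ & D1 & DD1 & L1).
  destruct (H2 t Ht) as (_ & _ & D2 & DD2 & L2).
  apply complex_derivable_is_Cderive in D1, DD1, D2, DD2.
  eapply is_Cderive_eq.
  - exact (is_Cderive_minus _ _ _ _ _
             (is_Cderive_mult _ _ _ _ _ DD1 D2)
             (is_Cderive_mult _ _ _ _ _ D1 DD2)).
  - unfold wronskian, Lop in *.
    set (p := coefL1 _ _ _ _) in *; set (q := coefL0 _ _ _ _ _) in *.
    transitivity
      ((C_derive (C_derive f1) t + p * C_derive f1 t + q * f1 t) * f2 t
       - f1 t * (C_derive (C_derive f2) t + p * C_derive f2 t + q * f2 t)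
       - p * (C_derive f1 t * f2 t - f1 t * C_derive f2 t)); [ring|].
    rewrite L1, L2; ring.
Qed.

(** The reciprocal of the derivative of [f1 / f2], that is, [dt / dtau] as a function of [t]. *)
Definition ratio_speed (f1 f2 : C -> C) (t : C) : C :=
  f2 t ^ 2 / wronskian f1 f2 t.

(** Differentiating [f1 (T s) / f2 (T s) = s] gives [C_derive T s * wronskian f1 f2 (T s) = f2 (T s)
    ^ 2], whose right side is nonzero. *)
Lemma local_inverse_derive (U V : C -> Prop) (f1 f2 T : C -> C) (s : C) :
  open V -> local_inverse_of_ratio U V f1 f2 T -> V s ->
  complex_derivable f1 (T s) -> complex_derivable f2 (T s) ->
  wronskian f1 f2 (T s) <> 0 /\
  is_Cderive T s (ratio_speed f1 f2 (T s)).
Proof.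
  intros HV HT Hs D1 D2.
  destruct (HT s Hs) as (_ & Hnz & DT & Hr).
  apply complex_derivable_is_Cderive in D1, D2, DT.
  pose proof (is_Cderive_div _ _ _ _ _ (is_Cderive_comp _ _ _ _ _ D1 DT)
                (is_Cderive_comp _ _ _ _ _ D2 DT) Hnz) as DR.
  assert (DR1 := is_Cderive_ext_open V _ (fun x => x) s _ HV Hs
                   (fun x Hx => proj2 (proj2 (proj2 (HT x Hx)))) DR).
  apply is_C_derive_unique in DR1.
  rewrite (is_C_derive_unique _ _ _ (is_Cderive_id s)) in DR1.
  assert (E : C_derive T s * wronskian f1 f2 (T s) = f2 (T s) ^ 2).
  { transitivity (1 * f2 (T s) ^ 2); [|ring].
    rewrite DR1; unfold wronskian; field; exact Hnz. }
  assert (HW : wronskian f1 f2 (T s) <> 0).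
  { intros H0; rewrite H0, Cmult_0_r in E.
    apply (Cpow_nz _ 2 Hnz); symmetry; exact E. }
  split; [exact HW|].
  apply (is_Cderive_eq _ _ _ _ DT).
  unfold ratio_speed; rewrite <- E; field; exact HW.
Qed.

Lemma ratio_speed_derive (alpha beta gamma tstar : C) (U : C -> Prop)
    (f1 f2 : C -> C) (t : C) :
  solution_on alpha beta gamma tstar U f1 ->
  solution_on alpha beta gamma tstar U f2 -> U t ->
  wronskian f1 f2 t <> 0 ->
  is_Cderive (ratio_speed f1 f2) t
    (2 * (C_derive f2 t * f2 t / wronskian f1 f2 t)
     + coefL1 alpha beta tstar t * ratio_speed f1 f2 t).
Proof.
  intros H1 H2 Ht HW.
  destruct (H2 t Ht) as (_ & _ & D2 & _ & _).
  apply complex_derivable_is_Cderive in D2.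
  eapply is_Cderive_eq.
  - exact (is_Cderive_div _ _ _ _ _ (is_Cderive_pow _ _ _ 1 D2)
             (wronskian_derive _ _ _ _ _ _ _ _ H1 H2 Ht) HW).
  - unfold ratio_speed; simpl INR; rewrite RtoC_plus; field; exact HW.
Qed.

(** The differentiated function is [u] expressed in [t]. The [coefL1] terms coming from the second
    derivative of [f2] and from the Wronskian cancel. *)
Lemma riccati_derive (alpha beta gamma tstar : C) (U : C -> Prop)
    (f1 f2 : C -> C) (t : C) :
  solution_on alpha beta gamma tstar U f1 ->
  solution_on alpha beta gamma tstar U f2 -> U t ->
  wronskian f1 f2 t <> 0 ->
  is_Cderive (fun x => C_derive f2 x * f2 x / wronskian f1 f2 x) t
    ((C_derive f2 t ^ 2 - coefL0 alpha beta gamma tstar t * f2 t ^ 2)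
     / wronskian f1 f2 t).
Proof.
  intros H1 H2 Ht HW.
  destruct (H2 t Ht) as (_ & _ & D2 & DD2 & L2).
  apply complex_derivable_is_Cderive in D2, DD2.
  eapply is_Cderive_eq.
  - exact (is_Cderive_div _ _ _ _ _ (is_Cderive_mult _ _ _ _ _ DD2 D2)
             (wronskian_derive _ _ _ _ _ _ _ _ H1 H2 Ht) HW).
  - unfold Lop in L2.
    set (p := coefL1 _ _ _ _) in *; set (q := coefL0 _ _ _ _ _) in *.
    replace (C_derive (C_derive f2) t)
      with ((C_derive (C_derive f2) t + p * C_derive f2 t + q * f2 t)
            - p * C_derive f2 t - q * f2 t) by ring.
    rewrite L2; field; exact HW.
Qed.

(** The last summand is exactly what [useq] subtracts at weight [2 * S m], so a single multiple of
    the next power of [x] survives. *)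
Lemma weighted_derive (h T x : C -> C) (s h' p u : C) (m : nat) :
  is_Cderive T s (x s) ->
  is_Cderive x s (x s * (2 * u + p * x s)) ->
  is_Cderive h (T s) h' ->
  is_Cderive (fun s => h (T s) * x s ^ S m) s
    ((h' + INR (S m) * p * h (T s)) * x s ^ S (S m)
     + INR (2 * S m) * u * (h (T s) * x s ^ S m)).
Proof.
  intros DT Dx Dh; eapply is_Cderive_eq.
  - exact (is_Cderive_mult _ _ _ _ _ (is_Cderive_comp _ _ _ _ _ Dh DT)
             (is_Cderive_pow _ _ _ m Dx)).
  - rewrite mult_INR, RtoC_mult; simpl (INR 2); rewrite RtoC_plus.
    simpl Cpow; ring.
Qed.

(** * The rational functions of [t] occurring in [u_4], [u_6], [u_8] *)

Definition h4 (alpha beta gamma tstar t : C) : C :=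
  - coefL0 alpha beta gamma tstar t.

(* [h6 / h4], i.e. the logarithmic derivative of [h4] plus twice [coefL1] *)
Definition r64 (alpha beta tstar t : C) : C :=
  2 * (alpha + beta - 1) / t + (1 - 2 * alpha) / (t - tstar).

Definition r64' (alpha beta tstar t : C) : C :=
  - (2 * (alpha + beta - 1)) / t ^ 2 - (1 - 2 * alpha) / (t - tstar) ^ 2.

Definition h6 (alpha beta gamma tstar t : C) : C :=
  h4 alpha beta gamma tstar t * r64 alpha beta tstar t.

Definition h8 (alpha beta gamma tstar t : C) : C :=
  h4 alpha beta gamma tstar t
  * (r64 alpha beta tstar t ^ 2
     + coefL1 alpha beta tstar t * r64 alpha beta tstar t
     + r64' alpha beta tstar t).

(** The factor [/ (t ^ 2 * (t - tstar))] has logarithmic derivative [- 2 / t - 1 / (t - tstar)];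
    adding [2 * coefL1] gives [r64]. *)
Lemma h4_derive (alpha beta gamma tstar t : C) :
  t <> 0 -> t <> tstar ->
  is_Cderive (h4 alpha beta gamma tstar) t
    (h6 alpha beta gamma tstar t
     - 2 * coefL1 alpha beta tstar t * h4 alpha beta gamma tstar t).
Proof.
  intros H0 Ht.
  assert (Ht' : t - tstar <> 0) by (apply Cminus_eq_contra, Ht).
  assert (H4 : RtoC 4 <> 0) by (intros E; apply RtoC_inj in E; lra).
  eapply is_Cderive_eq.
  - apply (is_Cderive_ext_open (fun _ => True)
             (fun x => 0 - coefL0 alpha beta gamma tstar x)).
    + intros x _; apply filter_true.
    + exact I.
    + intros x _; unfold h4; ring.
    + apply is_Cderive_minus; [apply is_Cderive_const|].
      apply is_Cderive_div; [apply is_Cderive_const| |].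
      * apply (is_Cderive_mult (fun x => 4 * x ^ 2) (fun x => x - tstar)).
        -- apply (is_Cderive_mult (fun _ => RtoC 4) (fun x => x ^ 2));
             [apply is_Cderive_const|].
           apply (is_Cderive_pow (fun x => x)), is_Cderive_id.
        -- apply is_Cderive_minus; [apply is_Cderive_id|apply is_Cderive_const].
      * apply Cmult_neq_0; [|exact Ht'].
        apply Cmult_neq_0; [exact H4 | apply Cpow_nz, H0].
  - unfold h6, h4, r64, coefL1, coefL0; simpl INR; rewrite RtoC_plus.
    field; auto.
Qed.

Lemma r64_derive (alpha beta tstar t : C) :
  t <> 0 -> t <> tstar ->
  is_Cderive (r64 alpha beta tstar) t (r64' alpha beta tstar t).
Proof.
  intros H0 Ht.
  assert (Ht' : t - tstar <> 0) by (apply Cminus_eq_contra, Ht).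
  eapply is_Cderive_eq.
  - exact (is_Cderive_plus _ _ _ _ _
             (is_Cderive_div _ _ _ _ _
                (is_Cderive_const (2 * (alpha + beta - 1)) t)
                (is_Cderive_id t) H0)
             (is_Cderive_div _ _ _ _ _
                (is_Cderive_const (1 - 2 * alpha) t)
                (is_Cderive_minus _ _ _ _ _
                   (is_Cderive_id t) (is_Cderive_const tstar t)) Ht')).
  - unfold r64'; field; auto.
Qed.

(** In [h4' * r64 + h4 * r64'] the term [- 2 * coefL1 * h6] arises; writing it as
    [coefL1 * h6 - 3 * coefL1 * h6] produces [h8]. *)
Lemma h6_derive (alpha beta gamma tstar t : C) :
  t <> 0 -> t <> tstar ->
  is_Cderive (h6 alpha beta gamma tstar) t
    (h8 alpha beta gamma tstar t
     - 3 * coefL1 alpha beta tstar t * h6 alpha beta gamma tstar t).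
Proof.
  intros H0 Ht; eapply is_Cderive_eq.
  - exact (is_Cderive_mult _ _ _ _ _ (h4_derive _ _ _ _ _ H0 Ht)
             (r64_derive _ _ _ _ H0 Ht)).
  - unfold h8, h6; ring.
Qed.

(** * The algebraic relation between [h4], [h6] and [h8] *)

Lemma h_relation (alpha beta gamma tstar t : C) :
  t <> 0 -> t <> tstar ->
  let a := h4 alpha beta gamma tstar t in
  let b := h6 alpha beta gamma tstar t in
  let c := h8 alpha beta gamma tstar t in
  C88 alpha beta gamma * a ^ 2 * c ^ 2
  + C86 alpha beta gamma * a * b ^ 2 * c
  + C84 alpha beta gamma * a ^ 4 * c
  + C66 alpha beta gamma * b ^ 4
  + C64 alpha beta gamma * a ^ 3 * b ^ 2
  + C44 alpha beta * a ^ 6 = 0.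
Proof.
  intros H0 Ht a b c.
  assert (Ht' : t - tstar <> 0) by (apply Cminus_eq_contra, Ht).
  assert (H4 : RtoC 4 <> 0) by (intros E; apply RtoC_inj in E; lra).
  set (k := (alpha + beta - gamma - 1) * (alpha + beta + gamma - 1)).
  (* [h4 = k y], so the relation divided by [h4 ^ 4 * k ^ 2] is free of
     [gamma], and it is polynomial in [v] and [w]. *)
  set (v := / t); set (w := / (t - tstar)).
  set (y := v * (w - v) / 4).
  (* Since [w - v = tstar * v * w], the variable [y] absorbs [tstar] as well. *)
  assert (Ha : a = k * y).
  { unfold a, k, y, v, w, h4, coefL0; field; auto. }
  set (r := r64 alpha beta tstar t).
  set (z := r ^ 2 + coefL1 alpha beta tstar t * r + r64' alpha beta tstar t).
  assert (Hb : b = a * r) by reflexivity.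
  assert (Hc : c = a * z) by reflexivity.
  assert (E : (2 * alpha - 1) * (2 * beta - 1) * z ^ 2
     - ((2 * alpha - 1) * (3 * beta - 1) + (3 * alpha - 1) * (2 * beta - 1))
       * r ^ 2 * z
     - 16 * (2 * alpha - 1) * (2 * beta - 1) * (alpha + beta - 1) * y * z
     + (3 * alpha - 1) * (3 * beta - 1) * r ^ 4
     + 4 * (2 * (2 * alpha - 1) ^ 2 * (3 * beta - 1)
            + 2 * (3 * alpha - 1) * (2 * beta - 1) ^ 2
            - 3 * (alpha - beta) ^ 2) * y * r ^ 2
     + 64 * (2 * alpha - 1) * (2 * beta - 1) * (alpha + beta - 1) ^ 2 * y ^ 2
     = 0).
  (* [r] is linear and [y], [z] are quadratic in [v] and [w], so [E] is an identity between quartic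
     forms in [v] and [w]. *)
  { assert (Hr : r = 2 * (alpha + beta - 1) * v + (1 - 2 * alpha) * w)
      by reflexivity.
    assert (Hz : z = r ^ 2 + ((alpha + beta) * v + (1 - alpha) * w) * r
                     - 2 * (alpha + beta - 1) * v ^ 2
                     - (1 - 2 * alpha) * w ^ 2).
    { unfold z, r64', coefL1, v, w; field; auto. }
    rewrite Hz, Hr; unfold y; field; exact H4. }
  (* Multiplying [E] back, rather than dividing the goal, includes the case [k = 0]. *)
  transitivity (a ^ 4 * k ^ 2 * 0); [rewrite <- E | ring].
  rewrite Hb, Hc, Ha; unfold C88, C86, C84, C66, C64, C44, k; ring.
Qed.

(** * From functions of [t] to the sequence generated by [u] *)

Theorem theorem4 (alpha beta gamma tstar : C) (htstar : tstar <> 0)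
  (U : C -> Prop) (hU : open U) (f1 f2 : C -> C)
  (hf1 : solution_on alpha beta gamma tstar U f1)
  (hf2 : solution_on alpha beta gamma tstar U f2)
  (hind : lin_indep_on U f1 f2)
  (V : C -> Prop) (hV : open V) (T : C -> C)
  (hT : local_inverse_of_ratio U V f1 f2 T) :
  let u := log_derivative (fun s => f2 (T s)) in
  let u4 := useq u 0 in
  let u6 := useq u 1 in
  let u8 := useq u 2 in
  forall s, V s ->
    (complex_derivable u s /\ complex_derivable u4 s /\ complex_derivable u6 s)
    /\
    C88 alpha beta gamma * u4 s ^ 2 * u8 s ^ 2
    + C86 alpha beta gamma * u4 s * u6 s ^ 2 * u8 s
    + C84 alpha beta gamma * u4 s ^ 4 * u8 s
    + C66 alpha beta gamma * u6 s ^ 4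
    + C64 alpha beta gamma * u4 s ^ 3 * u6 s ^ 2
    + C44 alpha beta * u4 s ^ 6 = 0.
Proof.
  intros u u4 u6 u8.
  set (x := fun s => ratio_speed f1 f2 (T s)).
  set (p := fun s => coefL1 alpha beta tstar (T s)).
  assert (HT : forall s, V s -> U (T s) /\ f2 (T s) <> 0 /\
            wronskian f1 f2 (T s) <> 0 /\ is_Cderive T s (x s)).
  { intros s Hs; destruct (hT s Hs) as (HU & Hnz & _).
    destruct (hf1 _ HU) as (_ & _ & D1 & _).
    destruct (hf2 _ HU) as (_ & _ & D2 & _).
    destruct (local_inverse_derive U V f1 f2 T s hV hT Hs D1 D2).
    auto. }
  assert (Eu : forall s, V s ->
            u s = C_derive f2 (T s) * f2 (T s) / wronskian f1 f2 (T s)).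
  { intros s Hs; destruct (HT s Hs) as (HU & Hnz & HW & DT).
    destruct (hf2 _ HU) as (_ & _ & D2 & _).
    apply complex_derivable_is_Cderive in D2.
    unfold u, log_derivative.
    rewrite (is_C_derive_unique _ _ _ (is_Cderive_comp _ _ _ _ _ D2 DT)).
    unfold x, ratio_speed; field; auto. }
  assert (Dx : forall s, V s ->
            is_Cderive x s (x s * (2 * u s + p s * x s))).
  { intros s Hs; destruct (HT s Hs) as (HU & Hnz & HW & DT).
    rewrite (Eu s Hs).
    apply (is_Cderive_comp (ratio_speed f1 f2) T); [|exact DT].
    exact (ratio_speed_derive _ _ _ _ _ _ _ _ hf1 hf2 HU HW). }
  (* Each of [S4], [S6], [S8] holds on all of [V], because the next differentiation needs the
     formula in a neighbourhood of [s]. *)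
  assert (S4 : forall s, V s -> complex_derivable u s /\
            u4 s = h4 alpha beta gamma tstar (T s) * x s ^ 2).
  { intros s Hs; destruct (HT s Hs) as (HU & Hnz & HW & DT).
    destruct (C_derive_ext_open V _ u s _ hV Hs Eu
                (is_Cderive_comp _ _ _ _ _
                   (riccati_derive _ _ _ _ _ _ _ _ hf1 hf2 HU HW) DT))
      as [Hd E].
    split; [exact Hd|].
    unfold u4; simpl useq; rewrite E, (Eu s Hs).
    unfold x, ratio_speed, h4; field; exact HW. }
  assert (S6 : forall s, V s -> complex_derivable u4 s /\
            u6 s = h6 alpha beta gamma tstar (T s) * x s ^ 3).
  { intros s Hs; destruct (HT s Hs) as (HU & Hnz & HW & DT).
    destruct (hf1 _ HU) as (H0 & Ht & _).
    destruct (C_derive_ext_open V _ u4 s _ hV Hs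
                (fun s Hs => proj2 (S4 s Hs))
                (weighted_derive _ _ _ _ _ _ _ 1 DT (Dx s Hs)
                   (h4_derive _ _ _ _ _ H0 Ht)))
      as [Hd E].
    split; [exact Hd|].
    (* The weight [2 * 0 + 4] is displayed as [2 * 2], the form [2 * S m] with [m = 1] produced by
       [weighted_derive]. *)
    change (C_derive u4 s - INR (2 * 2) * u s * u4 s
            = h6 alpha beta gamma tstar (T s) * x s ^ 3).
    rewrite E, (proj2 (S4 s Hs)); unfold p.
    replace (INR 2) with 2%R by (simpl; ring); ring. }
  assert (S8 : forall s, V s -> complex_derivable u6 s /\
            u8 s = h8 alpha beta gamma tstar (T s) * x s ^ 4).
  { intros s Hs; destruct (HT s Hs) as (HU & Hnz & HW & DT).
    destruct (hf1 _ HU) as (H0 & Ht & _).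
    destruct (C_derive_ext_open V _ u6 s _ hV Hs
                (fun s Hs => proj2 (S6 s Hs))
                (weighted_derive _ _ _ _ _ _ _ 2 DT (Dx s Hs)
                   (h6_derive _ _ _ _ _ H0 Ht)))
      as [Hd E].
    split; [exact Hd|].
    change (C_derive u6 s - INR (2 * 3) * u s * u6 s
            = h8 alpha beta gamma tstar (T s) * x s ^ 4).
    rewrite E, (proj2 (S6 s Hs)); unfold p.
    replace (INR 3) with 3%R by (simpl; ring); ring. }
  intros s Hs.
  destruct (S4 s Hs) as [D0 E4], (S6 s Hs) as [D4 E6], (S8 s Hs) as [D6 E8].
  split; [auto|].
  destruct (HT s Hs) as (HU & _).
  destruct (hf1 _ HU) as (H0 & Ht & _).
  (* Each of the six monomials contributes exactly the factor [x s ^ 12]. *)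
  transitivity (x s ^ 12 * 0); [|ring].
  rewrite <- (h_relation alpha beta gamma tstar (T s) H0 Ht), E4, E6, E8.
  ring.
Qed.
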